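(* Let $S^1,\ldots,S^N$ be nonempty finite sets, $\mathbf{S}=S^1\times\cdots\times S^N$, and for each $i=1,\ldots,N$ let $g^i,f^i:\mathbf{S}\to\mathbb{R}$ with $f^i>0$. Consider the associated Loomis game with strategy sets $\Delta^i$ and payoffs $h^i(p)=g^i(p)/f^i(p)$ on $\mathbf{\Delta}=\Delta^1\times\cdots\times\Delta^N$. A profile $p_0\in\mathbf{\Delta}$ is a Nash equilibrium of this Loomis game if and only if $$p_0\in\arg\min_{p\in\mathbf{\Delta}}\Big\{\max_{i=1,\ldots,N}\ \max_{s^i\in S^i}\big\{h^i(s^i,p^{-i})-h^i(p)\big\}\Big\}.$$
   Context: $\Delta^i$ is the set of probability distributions on $S^i$ (mixed strategies of player $i$). The functions $g^i,f^i$ are extended multilinearly to $\mathbf{\Delta}$: for $p=(p^1,\ldots,p^N)\in\mathbf{\Delta}$, $g^i(p)=\sum_{s=(s^1,\ldots,s^N)\in\mathbf{S}}p^1(s^1)\cdots p^N(s^N)\,g^i(s)$, and similarly for $f^i$. For a profile $p$, $p^{-i}$ denotes the strategies of the players other than $i$; $(\widetilde p^i,p^{-i})$ is the profile in which player $i$ uses $\widetilde p^i$ and the others use $p^{-i}$, and $(s^i,p^{-i})$ is the profile in which player $i$ uses the pure strategy $s^i$ (the Dirac distribution at $s^i$). A Nash equilibrium is a profile $p_0\in\mathbf{\Delta}$ such that $h^i(p_0)\ge h^i(\widetilde p^i,p_0^{-i})$ for every player $i$ and every $\widetilde p^i\in\Delta^i$. *)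

(* Defs.v *)
From HB Require Import structures.
From mathcomp Require Export all_boot all_order all_algebra.
From mathcomp Require Export classical_sets reals constructive_ereal.

Set Implicit Arguments.
Unset Strict Implicit.
Unset Printing Implicit Defensive.

Import Order.TTheory GRing.Theory Num.Theory.
Local Open Scope classical_set_scope.
Local Open Scope ring_scope.

Definition argmin d (V : porderType d) (T : Type) (D : set T) (F : T -> V) : set T :=
  [set x | D x /\ forall y, D y -> (F x <= F y)%O].

Definition mixed (R : realType) (A : finType) : set (A -> R) :=
  [set q | (forall a, 0 <= q a) /\ \sum_a q a = 1].

Definition pure (R : realType) (A : finType) (a : A) : A -> R :=
  fun b => (b == a)%:R.

(* For q : T i, [dfwith p q] is the profile (q, p^{-i}). *)
Definition nash (R : realType) (I : eqType) (T : I -> Type)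
    (X : forall i, set (T i)) (h : forall i : I, (forall j, T j) -> R) :
    set (forall i, T i) :=
  [set p | (forall i, X i (p i)) /\
           forall i (q : T i), X i q -> h i (dfwith p q) <= h i p].

Section Loomis.
Variables (R : realType) (N : nat) (S : 'I_N -> finType).

Definition mixed_profile : set (forall i, S i -> R) :=
  [set p | forall i, mixed (p i)].

Definition multilinear_ext (u : {dffun forall i, S i} -> R)
    (p : forall i, S i -> R) : R :=
  \sum_(s : {dffun forall i, S i}) (\prod_i p i (s i)) * u s.

Definition loomis_payoff (g f : 'I_N -> {dffun forall i, S i} -> R)
    (i : 'I_N) (p : forall i, S i -> R) : R :=
  multilinear_ext (g i) p / multilinear_ext (f i) p.

(* The maxima are taken in the extended reals, where -oo is neutral for max;
   for N > 0 and nonempty S i they are the maxima of the real quantities. *)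
Definition max_pure_gain (h : 'I_N -> (forall i, S i -> R) -> R)
    (p : forall i, S i -> R) : \bar R :=
  \big[maxe/-oo%E]_(i < N) \big[maxe/-oo%E]_(a : S i)
    (h i (dfwith p (pure R a : S i -> R)) - h i p)%:E.

End Loomis.

(* Main.v *)
(* The least possible value of the maximal gain is 0: since [h i p] is a mediant of
   the ratios [h i (s, p^{-i})], some pure reply does at least as well as [p i], so
   the gain is nonnegative, and it is nonpositive exactly at Nash equilibria. What
   remains is that the infimum is not positive, for which approximate equilibria
   are enough.

   They come from a KKM-type covering property of the simplex on the disjoint
   union of the [S i], itself a consequence of Scarf's ordinal version of Sperner's
   lemma. A point [x] of that simplex is covered by the label [(i, s)] if the block
   [i] has the smallest mass and [s] is a best reply of [i] to the (unnormalized)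
   opponents' blocks. At a point where every label of positive weight is
   nearly covered, all blocks have nearly equal mass, and every pure strategy
   with non-negligible weight is nearly a best reply; payoffs are homogeneous of
   degree 0 in each block, so normalizing the blocks changes nothing. *)

From mathcomp Require Import all_boot.
Set Implicit Arguments.
Unset Strict Implicit.
Unset Printing Implicit Defensive.

(** * Scarf's lemma *)

Section Scarf.
Local Open Scope nat_scope.
Variables (X C : finType) (r : C -> X -> nat).
Hypothesis r_inj : forall c, injective (r c).
Implicit Types (t : {set X}) (E : {set C}) (d s : {set X} * {set C}).

(** Each [r c] is a linear order on [X]. For nonempty [t], dominance says that no point exceeds the
    minimum of [t] in all orders [c] of [E] at once. *)
Definition dominant (t : {set X}) (E : {set C}) :=
  [forall y, [exists c in E, [forall x in t, r c y <= r c x]]].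

(** Rooms and doors play the part of the full cells and their facets in a triangulation. A door
    leads to a room by gaining a point or by losing a label. *)
Definition room (s : {set X} * {set C}) := dominant s.1 s.2 && (#|s.2| == #|s.1|).

Definition door (d : {set X} * {set C}) :=
  dominant d.1 d.2 && (#|d.2| == #|d.1|.+1).

Definition adjacent (d s : {set X} * {set C}) :=
  (d.2 == s.2) && (d.1 \subset s.1) || (d.1 == s.1) && (s.2 \subset d.2).

Lemma dominantP t E :
  reflect (forall y, exists2 c, c \in E & forall x, x \in t -> r c y <= r c x)
          (dominant t E).
Proof.
apply: (iffP forallP) => H y.
  by have /exists_inP[c cE /forall_inP ?] := H y; exists c.
by have [c cE ?] := H y; apply/exists_inP; exists c => //; apply/forall_inP.
Qed.

Lemma dominantW (t t' : {set X}) (E E' : {set C}) :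
  t' \subset t -> E \subset E' -> dominant t E -> dominant t' E'.
Proof.
move=> /subsetP tt /subsetP EE /dominantP H; apply/dominantP => y.
by have [c /EE cE ct] := H y; exists c => // x /tt /ct.
Qed.

(** Dominance applied to a point [x] of [t] itself provides an order of [E] in which [x] is the
    minimum, so the minima exhaust [t]. *)
Lemma dominant_min_fun t E : dominant t E -> t != set0 ->
  exists m : C -> X, (forall c, m c \in t) /\
    (forall c x, x \in t -> r c (m c) <= r c x) /\ m @: E = t.
Proof.
move=> /dominantP dom /set0Pn[x0 x0t].
exists (fun c => [arg min_(x < x0 in t) r c x]).
have mt c : [arg min_(x < x0 in t) r c x] \in t by case: arg_minnP.
have mm c x : x \in t -> r c [arg min_(x < x0 in t) r c x] <= r c x.
  by case: arg_minnP => // i _ + xt; apply.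
split=> //; split=> //; apply/setP => x; apply/imsetP/idP => [[c _ ->]//|xt].
have [c cE cx] := dom x; exists c => //.
by apply: (@r_inj c); apply/eqP; rewrite eqn_leq cx//= mm.
Qed.

(* With [m c] the [r c]-minimum of [d.1], a door (|d.2| = |d.1| + 1) has [m] onto
   [d.1], so exactly one pair of its labels share their minimum; these two are
   the redundant ones, and each yields one adjacent room. *)
Definition redundant (d : {set X} * {set C}) a :=
  (a \in d.2) && [forall x in d.1, [exists c in d.2 :\ a,
     [forall x' in d.1, r c x <= r c x']]].

Definition above (d : {set X} * {set C}) a :=
  [set y | [forall c in d.2 :\ a, [exists x in d.1, r c x < r c y]]].

(* Dropping the redundant label [a] leaves a dominant pair unless some point lies
   above; then adding the [r a]-largest such point restores dominance. *)
Definition room_across (d : {set X} * {set C}) a : {set X} * {set C} :=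
  if [pick x in above d a | [forall y in above d a, r a y <= r a x]] is Some x
  then (x |: d.1, d.2) else (d.1, d.2 :\ a).

Lemma redundantP d a :
  reflect (a \in d.2 /\ forall x, x \in d.1 -> exists2 c, c \in d.2 :\ a &
             forall x', x' \in d.1 -> r c x <= r c x')
          (redundant d a).
Proof.
apply: (iffP andP) => -[aE H]; split=> //.
  move=> x xt; have /exists_inP[c cE /forall_inP ?] := forall_inP H x xt.
  by exists c.
apply/forall_inP => x xt; have [c cE ?] := H x xt.
by apply/exists_inP; exists c => //; apply/forall_inP.
Qed.

Lemma aboveP d a y :
  reflect (forall c, c \in d.2 :\ a -> exists2 x, x \in d.1 & r c x < r c y)
          (y \in above d a).
Proof.
rewrite inE; apply: (iffP forall_inP) => H c cE; first exact/exists_inP/H.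
exact/exists_inP/H.
Qed.

Lemma above_notin d a x : redundant d a -> x \in above d a -> x \notin d.1.
Proof.
move=> /redundantP[_ red] /aboveP ab; apply/negP => xt.
have [c cE cx] := red x xt; have [x' x't] := ab c cE.
by rewrite ltnNge cx.
Qed.

Lemma above_le d a x y : dominant d.1 d.2 -> y \in above d a -> x \in d.1 ->
  r a y <= r a x.
Proof.
move=> /dominantP dom /aboveP ab xt; have [c cE cy] := dom y.
have [<-|ca] := eqVneq c a; first exact: cy.
have [|x' x't] := ab c; first by rewrite !inE ca.
by rewrite ltnNge cy.
Qed.

Variant room_across_spec d a : {set X} * {set C} -> Prop :=
| RoomAcrossAdd x of x \in above d a & (forall y, y \in above d a -> r a y <= r a x) :
    room_across_spec d a (x |: d.1, d.2)
| RoomAcrossRem of above d a =i pred0 : room_across_spec d a (d.1, d.2 :\ a).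

Lemma room_acrossP d a : room_across_spec d a (room_across d a).
Proof.
rewrite /room_across; case: pickP => [x /andP[xa /forall_inP ?]|no].
  exact: RoomAcrossAdd.
apply: RoomAcrossRem => y; apply/negbTE/negP => ya.
have [i ia imax] := @arg_maxnP _ y (mem (above d a)) (r a) ya.
have /negP[] := negbT (no i); apply/andP; split; first exact: ia.
by apply/forall_inP => z; apply: imax.
Qed.

(** When a highest point [x] is added, points above [d] are dominated through [a] by maximality of
    [x]. Any other point keeps a label [c != a] in which it lies below all of [d.1], hence below
    [x], which exceeds some point of [d.1] in that order. *)
Lemma room_across_room d a : door d -> redundant d a ->
  room (room_across d a) && adjacent d (room_across d a).
Proof.
move=> /andP[dom /eqP cd] red.
have [aE redE] := redundantP _ _ red.
rewrite /room /adjacent; case: room_acrossP => [x xa xmax|no] /=.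
  rewrite cardsU1 (above_notin red xa) cd add1n !eqxx subsetUr !andbT.
  apply/dominantP => y; have [ya|/negP yNa] := boolP (y \in above d a).
    exists a => // z; rewrite !inE => /predU1P[->|zt]; first exact: xmax.
    exact: above_le zt.
  have /exists_inP[c cE /exists_inPn cy] :
      [exists c in d.2 :\ a, ~~ [exists x in d.1, r c x < r c y]].
    by rewrite -negb_forall_in; apply/negP; rewrite inE in yNa.
  have {}cy z : z \in d.1 -> r c y <= r c z by move=> /cy; rewrite -leqNgt.
  exists c => [|z]; first by move: cE; rewrite inE => /andP[].
  rewrite !inE => /predU1P[->|/cy//].
  have [x' x't x'x] := aboveP _ _ _ xa c cE.
  exact: leq_trans (cy _ x't) (ltnW x'x).
rewrite eqxx subsetDl orbT andbT; apply/andP; split; last first.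
  by move: cd; rewrite (cardsD1 a d.2) aE  !add1n => -[->].
apply/dominantP => y; have := no y; rewrite inE => /negbT.
rewrite negb_forall_in => /exists_inP[c cE /exists_inPn cy]; exists c => // z.
by move=> /cy; rewrite -leqNgt.
Qed.

(** A point added for two distinct labels would exceed the minimum of [d.1] in every label of [d.2],
    against dominance. In the other cases the label sets differ. *)
Lemma room_across_inj d : door d ->
  {in [set a | redundant d a] &, injective (room_across d)}.
Proof.
move=> /andP[/dominantP dom _] a b; rewrite !inE => ra rb.
have [aE _] := redundantP _ _ ra; have [bE _] := redundantP _ _ rb.
have D1 c : c \in d.2 -> d.2 = d.2 :\ c -> False.
  by move=> cE /setP/(_ c); rewrite cE !inE eqxx.
case: room_acrossP => [x xa _|_]; case: room_acrossP => [y yb _|_] //.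
- move=> [/setP/(_ x)]; rewrite !inE eqxx (negbTE (above_notin ra xa)) !orbF.
  move=> /esym/eqP xy; subst y.
  have [c cE cx] := dom x; have [//|ab] := eqVneq a b.
  have [ca|ca] := eqVneq c a.
    have [|z zt] := aboveP _ _ _ yb c; first by rewrite !inE ca ab -?ca.
    by rewrite ltnNge cx.
  have [|z zt] := aboveP _ _ _ xa c; first by rewrite !inE ca.
  by rewrite ltnNge cx.
- by move=> [_ /(D1 _ bE)].
- by move=> [_ /esym /(D1 _ aE)].
- move=> [/setP/(_ a)]; rewrite !inE eqxx aE andbT.
  by case: eqVneq.
Qed.

Lemma room_across_surj d s : door d -> room s -> adjacent d s ->
  exists2 a, redundant d a & s = room_across d a.
Proof.
move=> /andP[dom /eqP cd] /andP[doms /eqP cs] /orP[]/andP[/eqP e sub].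
- have [x xt st] : exists2 x, x \notin d.1 & s.1 = x |: d.1.
    have /cards1P[x ex] : #|s.1 :\: d.1| == 1.
      by rewrite cardsD (setIidPr sub) -cs -e cd subSnn.
    exists x; first by have := set11 x; rewrite -ex inE => /andP[].
    rewrite -ex; apply/setP => z; rewrite !inE.
    by have [/(subsetP sub)->|] := boolP (z \in d.1); case: (z \in s.1).
  have xs : x \in s.1 by rewrite st setU11.
  have [|m [mt [mmin mE]]] := dominant_min_fun doms.
    by apply/set0Pn; exists x.
  have minj : {in s.2 &, injective m}.
    by apply/imset_injP; rewrite mE cs.
  (* Equal cardinalities make the minimum map [m] of the room injective, so the new point [x] is the
     minimum for exactly one label; that label is the redundant one. *)
  have [a aE xa] : exists2 a, a \in s.2 & x = m a by apply/imsetP; rewrite mE.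
  have mD c : c \in s.2 -> c != a -> m c \in d.1.
    move=> cE ca; have := mt c; rewrite st !inE => /predU1P[cx|//].
    by case/negP: ca; apply/eqP/minj => //; rewrite -xa.
  have red : redundant d a.
    apply/redundantP; rewrite e; split=> // z zt.
    have /imsetP[c cE zc] : z \in m @: s.2 by rewrite mE st !inE zt orbT.
    exists c => [|z' z't].
      rewrite !inE cE andbT; apply: contraNneq xt => ca.
      by rewrite xa -ca -zc.
    by rewrite zc; apply: mmin; rewrite st !inE z't orbT.
  have xab : x \in above d a.
    apply/aboveP => c; rewrite e !inE => /andP[ca cE]; exists (m c); first exact: mD.
    rewrite ltn_neqAle mmin// andbT; apply: contraNneq xt => /r_inj <-.
    exact: mD.
  have xmax y : y \in above d a -> r a y <= r a x.
    move=> /aboveP ya; have [c cE cy] := dominantP _ _ doms y.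
    have [<-|ca] := eqVneq c a; first exact: cy.
    have [|z zt] := ya c; first by rewrite e !inE ca.
    by rewrite ltnNge cy // st !inE zt orbT.
  exists a => //; case: room_acrossP => [y yab ymax|/(_ x)]; last by rewrite xab.
  have -> : y = x by apply: (@r_inj a); apply/eqP; rewrite eqn_leq xmax // ymax.
  by rewrite -st e -surjective_pairing.
- have /cards1P[a ea] : #|d.2 :\: s.2| == 1.
    by rewrite cardsD (setIidPr sub) cd e cs subSnn.
  have := set11 a; rewrite -ea inE => /andP[aNs aE].
  have st : s.2 = d.2 :\ a.
    rewrite -ea; apply/setP => z; rewrite !inE.
    by have [/(subsetP sub)->|] := boolP (z \in s.2); case: (z \in d.2).
  exists a.
    apply/redundantP; split=> // x xt; rewrite -st e; exact: (dominantP _ _ doms).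
  case: room_acrossP => [x /aboveP xab _|_]; last first.
    by rewrite e -st -surjective_pairing.
  have [c cE cx] := dominantP _ _ doms x.
  have [|z zt] := xab c; first by rewrite -st.
  by rewrite ltnNge cx// -e.
Qed.

Lemma card_adjacent_rooms d : door d ->
  #|[set s | room s && adjacent d s]| = #|[set a | redundant d a]|.
Proof.
move=> dd; rewrite -(card_in_imset (room_across_inj dd)); apply: eq_card => s.
apply/idP/imsetP; rewrite inE.
  by move=> /andP[rs /(room_across_surj dd rs)[a ra ->]]; exists a; rewrite ?inE.
by move=> [a]; rewrite inE => ra ->; apply: room_across_room.
Qed.

Lemma card_redundant d : door d -> d.1 != set0 -> #|[set a | redundant d a]| = 2.
Proof.
move=> /andP[dom /eqP cd] t0; have [m [mt [mmin mE]]] := dominant_min_fun dom t0.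
have [a aE [b bE [ab mab]]] :
    exists2 a, a \in d.2 & exists2 b, b \in d.2 & a != b /\ m a = m b.
  have /dinjectivePn[a aE [b]] : ~~ dinjectiveb m (mem d.2).
    apply/negP => /dinjectiveP/card_in_imset; rewrite mE cd.
    by move/eqP; rewrite ltn_eqF.
  by rewrite !inE => /andP[ba bE] mab; exists a => //; exists b; rewrite // eq_sym.
(* Redundancy of [c] means that the minimum map stays onto [d.1] without [c]. *)
have redE c : redundant d c = (c \in d.2) && (m @: (d.2 :\ c) == d.1).
  apply/redundantP/andP => -[cE H]; split=> //.
    rewrite eqEsubset; apply/andP; split.
      by apply/subsetP => _ /imsetP[e _ ->].
    apply/subsetP => x /[dup] xt /H[e eE ex]; apply/imsetP; exists e => //.
    by apply: (@r_inj e); apply/eqP; rewrite eqn_leq ex //= mmin.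
  move=> x; rewrite -(eqP H) => /imsetP[e eE ->]; exists e => // x'.
  by rewrite (eqP H); apply: mmin.
have swap c e : c \in d.2 -> e \in d.2 -> c != e -> m c = m e ->
    m @: (d.2 :\ c) == d.1.
  move=> cE eE ce mce; rewrite -mE eqEsubset imsetS ?subsetDl //=.
  apply/subsetP => _ /imsetP[i iE ->]; have [->|ic] := eqVneq i c.
    by rewrite mce imset_f // !inE eq_sym ce.
  by rewrite imset_f // !inE ic.
suff -> : [set a | redundant d a] = [set a; b] by rewrite cards2 ab.
apply/setP => c; rewrite !inE redE; apply/andP/orP => [[cE /eqP mc]|].
  have minj : {in d.2 :\ c &, injective m}.
    by apply/imset_injP; rewrite mc; move: cd; rewrite (cardsD1 c d.2) cE  !add1n => -[->].
  have [ac|ac] := eqVneq c a; first by left.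
  have [bc|bc] := eqVneq c b; first by right.
  by case/negP: ab; apply/eqP/minj; rewrite // !inE eq_sym ?ac ?bc.
case=> /eqP->; split=> //; first exact: swap mab.
by apply: swap (esym mab) => //; rewrite eq_sym.
Qed.

(** * Labelled doors and the parity argument *)

Variables (l : X -> C) (i0 : C).

(** As in Sperner's lemma, these are the almost fully labelled doors: [l] realizes every label of
    the door except the fixed [i0]. *)
Definition good_door d :=
  [&& door d, i0 \in d.2 & l @: d.1 == d.2 :\ i0].

Lemma good_door_set0 : good_door (set0, [set i0]).
Proof.
rewrite /good_door /door /= !inE eqxx imset0 setDv eqxx cards0 cards1 eqxx !andbT.
by apply/dominantP => y; exists i0; rewrite ?inE // => x; rewrite inE.
Qed.

Lemma good_door_eq0 d : good_door d -> d.1 = set0 -> d = (set0, [set i0]).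
Proof.
case: d => t E /and3P[_ /= iE /eqP lt] t0; move: lt; rewrite t0 imset0 => E0.
congr (_, _); apply/setP => c; move/setP/(_ c): E0; rewrite !inE.
by have [->|] := eqVneq c i0.
Qed.

(* Each good door is adjacent to two rooms, except the empty one, which is
   adjacent to a single room. *)
Lemma odd_good_door_incidences :
  odd (\sum_(d | good_door d) #|[set s | room s && adjacent d s]|).
Proof.
rewrite (bigD1 _ good_door_set0) /= card_adjacent_rooms; last first.
  by case/and3P: good_door_set0.
have -> : [set a | redundant (set0, [set i0]) a] = [set i0].
  apply/setP => a; rewrite !inE /redundant /= inE; case: eqP => //= _.
  by apply/forall_inP => x; rewrite inE.
rewrite cards1 oddD /= (_ : odd _ = false) //; apply/negbTE.
rewrite -dvdn2; apply: dvdn_sum => d /andP[gd dn].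
have dd : door d by case/and3P: gd.
rewrite card_adjacent_rooms // card_redundant //.
by apply: contraNneq dn => /(good_door_eq0 gd) ->.
Qed.

Lemma good_door_adjacent d s : good_door d -> room s -> adjacent d s ->
  [/\ i0 \in s.2, l @: d.1 = s.2 :\ i0 &
     exists2 x, x \in s.1 & d = (s.1 :\ x, s.2)] \/
  (exists2 c, c \notin s.2 & d = (s.1, c |: s.2)) /\ l @: s.1 = d.2 :\ i0.
Proof.
case: d s => t E [u D] /and3P[/andP[_ /= /eqP cd] iE /eqP lt] /andP[_ /= /eqP cs].
rewrite /adjacent /= => /orP[]/andP[/eqP e sub]; subst.
  left; split=> //; have /cards1P[x ex] : #|u :\: t| == 1.
    by rewrite cardsD (setIidPr sub) -cs cd subSnn.
  have := set11 x; rewrite -ex inE => /andP[xNt xu]; exists x => //.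
  rewrite -ex; congr (_, _); apply/setP => z; rewrite !inE.
  by have [/(subsetP sub)->|] := boolP (z \in t); case: (z \in u).
right; split=> //; have /cards1P[c ec] : #|E :\: D| == 1.
  by rewrite cardsD (setIidPr sub) cd cs subSnn.
have := set11 c; rewrite -ec inE => /andP[cND cE]; exists c => //.
rewrite -ec; congr (_, _); apply/setP => z; rewrite !inE.
by have [/(subsetP sub)->|] := boolP (z \in D); case: (z \in E).
Qed.

Lemma good_door_rem s x : room s -> x \in s.1 -> i0 \in s.2 ->
  l @: (s.1 :\ x) = s.2 :\ i0 ->
  good_door (s.1 :\ x, s.2) && adjacent (s.1 :\ x, s.2) s.
Proof.
move=> /andP[dom /eqP cs] xs iE lx; rewrite /good_door /adjacent /door /=.
rewrite (dominantW _ _ dom) ?subsetDl // iE lx !eqxx /= !andbT.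
by rewrite cs (cardsD1 x s.1) xs.
Qed.

Lemma good_door_add s c : room s -> c \notin s.2 -> i0 \in c |: s.2 ->
  l @: s.1 = (c |: s.2) :\ i0 ->
  good_door (s.1, c |: s.2) && adjacent (s.1, c |: s.2) s.
Proof.
move=> /andP[dom /eqP cs] cN iE lx; rewrite /good_door /adjacent /door /=.
rewrite (dominantW _ _ dom) ?subsetUr // iE lx !eqxx /= orbT !andbT.
by rewrite cardsU1 cN cs.
Qed.

(** If [l x] repeats the label of another point [y], the two good doors drop [x] or [y]. If [l x] is
    outside [s.2], the second good door adds the label [l x] instead. *)
Lemma card_good_doors_rem s x : room s -> l @: s.1 != s.2 -> x \in s.1 ->
  i0 \in s.2 -> l @: (s.1 :\ x) = s.2 :\ i0 ->
  #|[set d | good_door d && adjacent d s]| = 2.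
Proof.
move=> rs ncol xs iE lx; have /andP[_ /eqP cs] := rs.
have lsE : l @: s.1 = l x |: (s.2 :\ i0) by rewrite -(setD1K xs) imsetU1 lx.
have lxi : l x != i0.
  by apply: contraNneq ncol => lxi; rewrite lsE lxi setD1K.
have linj y : l @: (s.1 :\ y) = s.2 :\ i0 -> y \in s.1 -> {in s.1 :\ y &, injective l}.
  move=> ly ys; apply/imset_injP; rewrite ly.
  by move: cs; rewrite (cardsD1 i0 s.2) iE (cardsD1 y s.1) ys  !add1n => -[->].
have [lxD|lxD] := boolP (l x \in s.2).
  have /imsetP[y yx lxy] : l x \in l @: (s.1 :\ x) by rewrite lx !inE lxi.
  have [yNx ys] : y != x /\ y \in s.1 by move: yx; rewrite !inE => /andP[].
  have ly : l @: (s.1 :\ y) = s.2 :\ i0.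
    have ls : l @: s.1 = s.2 :\ i0.
      by rewrite lsE; apply/setUidPr; rewrite sub1set !inE lxi.
    apply/eqP; rewrite eqEsubset -{1}ls imsetS ?subsetDl //= -lx.
    apply/subsetP => _ /imsetP[z + ->]; rewrite !inE => /andP[zx zs].
    have [->|zy] := eqVneq z y; last by rewrite imset_f // !inE zy.
    by rewrite -lxy imset_f // !inE eq_sym yNx.
  suff -> : [set d | good_door d && adjacent d s] =
            [set (s.1 :\ x, s.2); (s.1 :\ y, s.2)].
    rewrite cards2; case: eqP => // -[] /setP/(_ y).
    by rewrite !inE yNx ys eqxx.
  apply/setP => d; rewrite !inE; apply/andP/orP; last first.
    by case=> /eqP->; apply/andP; apply: good_door_rem.
  move=> [gd ad]; have [[_ ld [z zs dE]]|[[c cN dE] ld]] := good_door_adjacent gd rs ad.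
    have {}ld : l @: (s.1 :\ z) = s.2 :\ i0 by rewrite -ld dE.
    have [zx|xz] := eqVneq z x; first by left; rewrite dE zx.
    have [zy|yz] := eqVneq z y; first by right; rewrite dE zy.
    by case/eqP: yNx; apply: (linj z ld zs); rewrite // !inE eq_sym ?yz ?xz.
  have linjs : {in s.1 &, injective l}.
    apply/imset_injP; rewrite ld.
    have /and3P[/andP[_ /eqP cd] idE _] := gd.
    by move: cd; rewrite (cardsD1 i0 d.2) idE dE  !add1n => -[->].
  by case/eqP: yNx; apply: linjs.
have lsE' : l @: s.1 = (l x |: s.2) :\ i0.
  rewrite lsE; apply/setP => c; rewrite !inE.
  by have [->|_] := eqVneq c (l x); rewrite ?lxi.
suff -> : [set d | good_door d && adjacent d s] =
            [set (s.1 :\ x, s.2); (s.1, l x |: s.2)].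
  rewrite cards2; case: eqP => // -[] /setP/(_ x).
  by rewrite !inE xs eqxx.
apply/setP => d; rewrite !inE; apply/andP/orP; last first.
  case=> /eqP->; apply/andP; first exact: good_door_rem.
  by apply: good_door_add; rewrite // !inE iE orbT.
move=> [gd ad]; have [[_ ld [z zs dE]]|[[c cN dE] ld]] := good_door_adjacent gd rs ad.
  left; have [zx|xz] := eqVneq z x; first by rewrite dE zx.
  have : l x \in l @: d.1 by rewrite dE imset_f // !inE eq_sym xz.
  by rewrite ld !inE (negbTE lxD) andbF.
right; have : l x \in l @: s.1 by exact: imset_f.
rewrite ld dE !inE (negbTE lxD) orbF => /andP[_ /eqP ->].
by rewrite eqxx.
Qed.

(** A good door that adds a label [c] to the room yields one that drops a point: the point labelled
    [c]. Here [c != i0], since otherwise the room would be fully labelled. *)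
Lemma even_good_doors s : room s -> l @: s.1 != s.2 ->
  ~~ odd #|[set d | good_door d && adjacent d s]|.
Proof.
move=> rs ncol; have [->|/set0Pn[d]] := eqVneq [set d | good_door d && adjacent d s] set0.
  by rewrite cards0.
rewrite inE => /andP[gd ad].
suff [x [xs iE lx]] : exists x, [/\ x \in s.1, i0 \in s.2 & l @: (s.1 :\ x) = s.2 :\ i0].
  by rewrite (card_good_doors_rem rs ncol xs iE lx).
have [[iE ld [x xs dE]]|[[c cN dE] ld]] := good_door_adjacent gd rs ad.
  by exists x; split=> //; rewrite -ld dE.
have /and3P[/andP[_ /eqP cd] idE _] := gd.
have ci : c != i0.
  apply: contraNneq ncol => ci; rewrite ld dE ci; apply/eqP/setP => z; rewrite !inE.
  by case: eqVneq => [->|//]; rewrite -ci (negbTE cN).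
have iE : i0 \in s.2 by move: idE; rewrite dE !inE eq_sym (negbTE ci).
have /imsetP[x xs cx] : c \in l @: s.1 by rewrite ld dE !inE eqxx ci.
exists x; split=> //.
have linjs : {in s.1 &, injective l}.
  apply/imset_injP; rewrite ld.
  by move: cd; rewrite (cardsD1 i0 d.2) idE dE  !add1n => -[->].
apply/setP => z; apply/imsetP/idP.
  move=> [y]; rewrite !inE => /andP[yx ys] ->.
  have : l y \in l @: s.1 by exact: imset_f.
  rewrite ld dE !inE => /andP[-> /predU1P[yc|//]].
  by case/eqP: yx; apply: linjs; rewrite // yc.
rewrite !inE => /andP[zi zs].
have /imsetP[y ys zy] : z \in l @: s.1 by rewrite ld dE !inE zi zs orbT.
exists y => //; rewrite !inE ys andbT; apply: contraNneq cN => yx.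
by rewrite cx -yx -zy.
Qed.

(* Counting incidences between good doors and rooms from the side of the rooms,
   a room with [l @: s.1 != s.2] has zero or two good doors. *)
Theorem scarf_lemma : exists s : {set X},
  forall y, exists2 c, c \in l @: s & forall x, x \in s -> r c y <= r c x.
Proof.
have [/existsP[s /andP[/andP[dom _] /eqP ls]]|ncol] :=
    boolP [exists s : {set X} * {set C}, room s && (l @: s.1 == s.2)].
  by exists s.1 => y; rewrite ls; apply: (dominantP _ _ dom).
have := odd_good_door_incidences.
suff -> : odd (\sum_(d | good_door d) #|[set s | room s && adjacent d s]|) = false by [].
under eq_bigr do rewrite -sum1_card big_mkcond.
rewrite exchange_big /=; apply/negbTE; rewrite -dvdn2; apply: dvdn_sum => s _.
rewrite -big_mkcondr /=.
have [rs|nrs] := boolP (room s); last first.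
  by rewrite big1 // => d; rewrite inE (negbTE nrs) andbF.
rewrite sum1_card dvdn2.
have -> : #|[pred d | good_door d && (s \in [set s | room s && adjacent d s])]| =
          #|[set d | good_door d && adjacent d s]|.
  by apply: eq_card => d; rewrite !inE rs.
apply: even_good_doors => //.
by move: ncol; rewrite negb_exists => /forallP/(_ s); rewrite rs.
Qed.

End Scarf.

Require Import Defs.
From mathcomp Require Import all_boot all_order all_algebra.
From mathcomp Require Import classical_sets reals constructive_ereal.
From mathcomp Require Import lra.
Import Order.TTheory GRing.Theory Num.Theory.
Local Open Scope classical_set_scope.
Local Open Scope ring_scope.

(** * Approximate KKM covering property *)

Section Grid.
Variables (C : finType) (n : nat).

(** Points of the simplex over [C] whose coordinates are multiples of [1/n], scaled by [n]. *)
Definition grid := {x : {ffun C -> 'I_n.+1} | (\sum_c (x c : nat) == n)%N}.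

Lemma sum_grid (x : grid) : (\sum_c (val x c : nat) = n)%N.
Proof. exact/eqP/(valP x). Qed.

Lemma grid_above (c0 : C) (a : C -> nat) : (\sum_c a c <= n)%N ->
  exists y : grid, forall c, (a c <= val y c)%N.
Proof.
(* All the missing mass goes to the coordinate [c0]. *)
move=> an; pose b c := (a c + (c == c0) * (n - \sum_e a e))%N.
have bn : (\sum_c b c = n)%N.
  rewrite big_split /= -big_distrl /=.
  have -> : (\sum_c (c == c0) = 1)%N.
    by rewrite (bigD1 c0) //= eqxx big1 // => c /negbTE ->.
  by rewrite mul1n subnKC.
have bE c : (inord (b c) : 'I_n.+1) = b c :> nat.
  by rewrite inordK // ltnS -bn (bigD1 c) //= leq_addr.
have yP : (\sum_c ([ffun c => inord (b c) : 'I_n.+1] c : nat) == n)%N.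
  by rewrite -[X in _ == X]bn; apply/eqP/eq_bigr => c _; rewrite ffunE bE.
exists (exist (fun x : {ffun C -> 'I_n.+1} => \sum_c x c == n)%N _ yP) => c.
by rewrite /= ffunE bE leq_addr.
Qed.

(** Lexicographic: the coordinate [c] first, then the enumeration of the grid as a tie-break that
    makes the order linear. *)
Definition grid_rank (c : C) (x : grid) : nat :=
  (val x c * #|{: grid}| + enum_rank x)%N.

Lemma grid_rank_inj c : injective (grid_rank c).
Proof.
move=> x y /(congr1 (modn^~ #|{: grid}|)).
by rewrite /grid_rank !modnMDl !modn_small // => /ord_inj/enum_rank_inj.
Qed.

Lemma grid_rank_le c x y : (grid_rank c y <= grid_rank c x)%N -> (val y c <= val x c)%N.
Proof.
rewrite leqNgt; apply: contraNleq => xy.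
apply: (@leq_trans ((val x c).+1 * #|{: grid}|)).
  by rewrite /grid_rank mulSn addnC ltn_add2r.
by rewrite (leq_trans _ (leq_addr _ _)) // leq_mul2r xy orbT.
Qed.

(* The labels of the small set [s] are those of Scarf's dominating set: a grid
   point exceeding by one the minimum over [s] of each labelled coordinate
   would contradict domination, so these minima almost add up to [n]. *)
Lemma grid_scarf (c0 : C) (l : grid -> C) :
  exists (s : {set grid}) (x0 : grid) (m : C -> nat),
    [/\ x0 \in s,
        forall x c, x \in s -> (m c <= val x c <= m c + #|C|)%N &
        forall c, c \notin l @: s -> m c = 0%N].
Proof.
have [s dom] := scarf_lemma grid_rank_inj l c0.
have [x0 x0s] : exists x0, x0 \in s.
  have [|y _] := @grid_above c0 (fun=> 0%N); first by rewrite big1.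
  by have [_ /imsetP[x0 x0s _] _] := dom y; exists x0.
pose m0 c := val [arg min_(x < x0 in s) (val x c : nat)] c : nat.
have m0le x c : x \in s -> (m0 c <= val x c)%N.
  by rewrite /m0; case: arg_minnP => // i _ + xs; apply.
pose m c := if c \in l @: s then m0 c else 0%N.
have mle x c : x \in s -> (m c <= val x c)%N.
  by rewrite /m; case: ifP => // _; apply: m0le.
have nm : (n < \sum_(c in l @: s) (m0 c).+1)%N.
  rewrite ltnNge; apply/negP; rewrite big_mkcond /= => /(grid_above c0)[y ya].
  have [c cl cy] := dom y; have := ya c; rewrite cl.
  have : (val y c <= m0 c)%N.
    by apply: grid_rank_le; apply: cy; case: arg_minnP.
  by move=> h1 h2; have := leq_trans h2 h1; rewrite ltnn.
have {}nm : (n <= \sum_c m c + #|C|)%N.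
  rewrite (leq_trans (ltnW nm)) // (eq_bigr (fun c => m0 c + 1)%N); last first.
    by move=> c _; rewrite addn1.
  rewrite big_split /= sum1_card [X in (X + _)%N]big_mkcond.
  by rewrite leq_add2l max_card.
exists s, x0, m; split=> // [x c xs|c]; last by rewrite /m => /negbTE ->.
rewrite mle //=.
(* The coordinates of [x] sum to [n], at most the sum of [m] plus [#|C|], and each is at least [m];
   so none exceeds [m] by more than [#|C|]. *)
have := leq_trans (eq_leq (sum_grid x)) nm; rewrite (bigD1 c) //=.
rewrite [X in (_ <= X + _)%N](bigD1 c) //=.
have : (\sum_(i | i != c) m i <= \sum_(i | i != c) val x i)%N.
  by apply: leq_sum => i _; apply: mle.
move=> h1 h2; rewrite -(leq_add2r (\sum_(i | i != c) val x i)).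
by rewrite (leq_trans h2) // (addnAC _ #|C|) leq_add2r leq_add2l.
Qed.

End Grid.

(** Label each point of a fine grid by a set that covers it. Scarf's small set has coordinatewise
    diameter at most [#|C|/n], and so bounds the coordinates of the labels it misses. *)
Lemma kkm_cover (R : realType) (C : finType) (A : C -> (C -> R) -> Prop) (delta : R) :
  (0 < #|C|)%N -> 0 < delta ->
  (forall x, mixed x -> exists c, A c x) ->
  exists z, mixed z /\ forall c, z c <= delta \/
    exists x, [/\ mixed x, A c x & forall c', `|x c' - z c'| <= delta].
Proof.
move=> /card_gt0P[c0 _] d0 cov.
pose n := Num.bound (#|C|%:R / delta).
have nC : #|C|%:R / delta < n%:R by apply: archi_boundP; rewrite divr_ge0 // ltW.
have n0 : 0 < n%:R :> R by rewrite (le_lt_trans _ nC) // divr_ge0 // ltW.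
have nd k : (k <= #|C|)%N -> k%:R / n%:R <= delta.
  move=> kC; rewrite ler_pdivrMr // mulrC -ler_pdivrMr // (le_trans _ (ltW nC)) //.
  by rewrite ler_pM2r ?invr_gt0 // ler_nat.
pose pt (x : grid C n) c : R := (val x c)%:R / n%:R.
have ptP x : mixed (pt x).
  split=> [c|]; first by rewrite /pt divr_ge0 // ltW.
  by rewrite -mulr_suml -natr_sum sum_grid divff // gt_eqF.
have /fin_all_exists[l lP] x : exists c, A c (pt x) by apply: cov.
have [s [x0 [m [x0s ms mN]]]] := grid_scarf c0 l.
exists (pt x0); split=> // c.
have [/imsetP[x xs ->]|cN] := boolP (c \in l @: s); last first.
  by left; apply: nd; have /andP[_] := ms x0 c x0s; rewrite mN.
right; exists (pt x); split=> // c'; rewrite /pt -mulrBl normrM normfV.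
have /andP[a1 b1] := ms x c' xs; have /andP[a2 b2] := ms x0 c' x0s.
rewrite [X in _ / X]ger0_norm; last exact: ltW.
have near (i j : nat) : (m c' <= i <= m c' + #|C|)%N -> (i <= j <= m c' + #|C|)%N ->
    `|j%:R - i%:R| / n%:R <= delta.
  move=> /andP[h1 h2] /andP[h3 h4]; rewrite -natrB // normr_nat; apply: nd.
  by rewrite leq_subLR (leq_trans h4) // leq_add2r.
have [le01|/ltnW le10] := leqP (val x0 c') (val x c').
  by apply: near; rewrite ?a2 ?b2 ?le01.
by rewrite distrC; apply: near; rewrite ?a1 ?b1 ?le10.
Qed.

(** * Approximate equilibria *)

Section BoundedLipschitz.
Variables (R : realType) (C : finType).
Implicit Types (phi psi : (C -> R) -> R) (x y : C -> R).

(** The distance is the sup distance, expressed through an upper bound [d]. The bound on [phi] is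
    carried along because products need it. *)
Definition bounded_lipschitz (K : R) phi := 0 <= K /\
  forall x, (forall c, 0 <= x c <= 1) -> `|phi x| <= K /\
  forall y d, (forall c, 0 <= y c <= 1) -> 0 <= d ->
    (forall c, `|x c - y c| <= d) -> `|phi x - phi y| <= K * d.

Definition is_bounded_lipschitz phi := exists K, bounded_lipschitz K phi.

Lemma bounded_lipschitzW K K' phi : K <= K' ->
  bounded_lipschitz K phi -> bounded_lipschitz K' phi.
Proof.
move=> KK [K0 H]; split=> [|x x01]; first exact: le_trans KK.
have [bd li] := H x x01; split=> [|y d y01 d0 xy]; first exact: le_trans KK.
by rewrite (le_trans (li y d y01 d0 xy)) // ler_wpM2r.
Qed.

Lemma eq_bounded_lipschitz phi psi : phi =1 psi ->
  is_bounded_lipschitz phi -> is_bounded_lipschitz psi.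
Proof.
move=> e [K [K0 H]]; exists K; split=> // x x01; have [bd li] := H x x01.
by split=> [|y d y01 d0 xy]; rewrite -!e //; apply: li.
Qed.

Lemma bounded_lipschitz_cst k : is_bounded_lipschitz (fun=> k).
Proof.
exists `|k|; split=> // x _; split=> // y d _ d0 _.
by rewrite subrr normr0 mulr_ge0.
Qed.

Lemma bounded_lipschitz_coord c : is_bounded_lipschitz (fun x => x c).
Proof.
exists 1; split=> // x x01; have /andP[x0 x1] := x01 c.
by split=> [|y d _ _ xy]; rewrite ?mul1r ?(ger0_norm x0).
Qed.

Lemma bounded_lipschitzD phi psi : is_bounded_lipschitz phi ->
  is_bounded_lipschitz psi -> is_bounded_lipschitz (fun x => phi x + psi x).
Proof.
move=> [K [K0 H]] [L [L0 H']]; exists (K + L); split=> [|x x01]; first exact: addr_ge0.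
have [bd li] := H x x01; have [bd' li'] := H' x x01.
split=> [|y d y01 d0 xy]; first by rewrite (le_trans (ler_normD _ _)) // lerD.
rewrite opprD addrACA mulrDl (le_trans (ler_normD _ _)) // lerD //.
  exact: li.
exact: li'.
Qed.

Lemma bounded_lipschitzM phi psi : is_bounded_lipschitz phi ->
  is_bounded_lipschitz psi -> is_bounded_lipschitz (fun x => phi x * psi x).
Proof.
move=> [K [K0 H]] [L [L0 H']]; exists (K * L + K * L).
have KL : 0 <= K * L by exact: mulr_ge0.
split=> [|x x01]; first exact: addr_ge0.
have [bd li] := H x x01; have [bd' li'] := H' x x01.
split=> [|y d y01 d0 xy].
  by rewrite normrM (@le_trans _ _ (K * L)) ?ler_pM // lerDl.
have [bdy _] := H y y01.
have -> : phi x * psi x - phi y * psi y =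
    (phi x - phi y) * psi x + phi y * (psi x - psi y).
  by rewrite mulrBl mulrBr addrA subrK.
rewrite (le_trans (ler_normD _ _)) // [leRHS]mulrDl !normrM lerD //.
  by rewrite mulrAC ler_pM //; apply: li.
by rewrite -mulrA ler_pM //; apply: li'.
Qed.

Lemma bounded_lipschitz_sum (I : finType) (P : pred I) (phi : I -> (C -> R) -> R) :
  (forall i, is_bounded_lipschitz (phi i)) ->
  is_bounded_lipschitz (fun x => \sum_(i | P i) phi i x).
Proof.
move=> H; elim: (index_enum I) => [|i s IH].
  apply: eq_bounded_lipschitz (bounded_lipschitz_cst 0) => x.
  by rewrite big_nil.
have [Pi|Pi] := boolP (P i).
  apply: eq_bounded_lipschitz (bounded_lipschitzD (H i) IH) => x.
  by rewrite big_cons Pi.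
by apply: eq_bounded_lipschitz IH => x; rewrite big_cons (negbTE Pi).
Qed.

Lemma bounded_lipschitz_prod (I : finType) (P : pred I) (phi : I -> (C -> R) -> R) :
  (forall i, is_bounded_lipschitz (phi i)) ->
  is_bounded_lipschitz (fun x => \prod_(i | P i) phi i x).
Proof.
move=> H; elim: (index_enum I) => [|i s IH].
  apply: eq_bounded_lipschitz (bounded_lipschitz_cst 1) => x.
  by rewrite big_nil.
have [Pi|Pi] := boolP (P i).
  apply: eq_bounded_lipschitz (bounded_lipschitzM (H i) IH) => x.
  by rewrite big_cons Pi.
by apply: eq_bounded_lipschitz IH => x; rewrite big_cons (negbTE Pi).
Qed.

Lemma bounded_lipschitz_unif (I : finType) (phi : I -> (C -> R) -> R) :
  (forall i, is_bounded_lipschitz (phi i)) ->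
  exists2 K, 0 <= K & forall i, bounded_lipschitz K (phi i).
Proof.
move=> /fin_all_exists[K KP].
have K0 i : 0 <= K i by case: (KP i).
exists (\sum_i K i) => [|i]; first exact: sumr_ge0.
by apply: bounded_lipschitzW (KP i); rewrite (bigD1 i) //= lerDl sumr_ge0.
Qed.

End BoundedLipschitz.

Lemma finite_pos_lower_bound (R : realType) (I : finType) (F : I -> R) :
  (forall i, 0 < F i) -> exists2 m, 0 < m & forall i, m <= F i.
Proof.
(* The initial value [1] keeps the bound positive for empty [I]. *)
move=> F0; exists (\big[Num.min/1]_i F i) => [|i]; last exact: bigmin_le.
by apply/bigmin_gtP; split.
Qed.

Lemma mixed_le1 (R : realType) (A : finType) (q : A -> R) a : mixed q -> 0 <= q a <= 1.
Proof.
move=> [q0 q1]; rewrite q0 -q1 (bigD1 a) //= lerDl; exact: sumr_ge0.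
Qed.

Lemma mixed_pure (R : realType) (A : finType) (a : A) : mixed (pure R a).
Proof.
split=> [b|]; first by rewrite /pure ler0n.
by rewrite (bigD1 a) //= big1 /pure ?eqxx ?addr0 // => b /negbTE ->.
Qed.

(** * Multilinear extensions *)

Section Multilinear.
Variables (R : realType) (N : nat) (S : 'I_N -> finType).
Implicit Types (u : {dffun forall i, S i} -> R) (z : forall i, S i -> R).

(** Distributivity for a dependent family: the inner sums are moved to the disjoint union of the
    [S i], and the choice functions are identified with dependent functions. *)
Lemma prod_sum_dffun z :
  \prod_i \sum_(a : S i) z i a = \sum_(s : {dffun forall i, S i}) \prod_i z i (s i).
Proof.
pose Z i : {ffun S i -> R} := [ffun a => z i a].
have -> : \prod_i \sum_(a : S i) z i a = \prod_i \sum_(a : S i) Z i a.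
  by apply: eq_bigr => i _; apply: eq_bigr => a _; rewrite ffunE.
rewrite (reindex _ (onW_bij _ (dffun_of_fprod_bij S))) /=.
under eq_bigr do rewrite (@big_tag _ _ _ _ S (fun i a => Z i a)).
rewrite (bigA_distr_big_dep _ (fun i j => untag 0 (Z i) j)).
rewrite -(@big_fprod R 0 1 *%R +%R _ S Z).
by apply: eq_bigr => t _; apply: eq_bigr => i _; rewrite !ffunE.
Qed.

Lemma prod_dfwith z i (q : S i -> R) (s : {dffun forall i, S i}) :
  \prod_j dfwith z q j (s j) = q (s i) * \prod_(j | j != i) z j (s j).
Proof.
rewrite (bigD1 i) //= dfwith_in; congr (_ * _); apply: eq_bigr => j ji.
by rewrite dfwith_out // eq_sym.
Qed.

Lemma multilinear_ext_id u z i : multilinear_ext u (dfwith z (z i)) = multilinear_ext u z.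
Proof.
by apply: eq_bigr => s _; rewrite prod_dfwith [in RHS](bigD1 i).
Qed.

Lemma multilinear_ext_dfwith u z i (q : S i -> R) :
  multilinear_ext u (dfwith z q) =
  \sum_a q a * multilinear_ext u (dfwith z (pure R a : S i -> R)).
Proof.
rewrite /multilinear_ext; under [RHS]eq_bigr do rewrite big_distrr.
rewrite exchange_big /=; apply: eq_bigr => s _.
rewrite prod_dfwith (bigD1 (s i)) //= [X in _ + X]big1 => [|a ai].
  by rewrite addr0 prod_dfwith /pure eqxx mul1r mulrA.
by rewrite prod_dfwith /pure eq_sym (negbTE ai) !mul0r mulr0.
Qed.

Lemma multilinear_ext_split u z i : multilinear_ext u z =
  \sum_a z i a * multilinear_ext u (dfwith z (pure R a : S i -> R)).
Proof. by rewrite -(multilinear_ext_id u z i) multilinear_ext_dfwith. Qed.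

(** The factor does not depend on [u], so it cancels in payoff ratios when blocks are normalized. *)
Lemma multilinear_ext_scale u z (k : 'I_N -> R) :
  multilinear_ext u (fun i a => k i * z i a) = (\prod_i k i) * multilinear_ext u z.
Proof.
by rewrite big_distrr; apply: eq_bigr => s _; rewrite /= big_split mulrA.
Qed.

Lemma multilinear_ext_scale_dfwith u z (k : 'I_N -> R) i (q : S i -> R) :
  multilinear_ext u (dfwith (fun i a => k i * z i a) q) =
  (\prod_(j | j != i) k j) * multilinear_ext u (dfwith z q).
Proof.
rewrite big_distrr; apply: eq_bigr => s _; rewrite !prod_dfwith big_split /=.
by rewrite mulrCA !mulrA.
Qed.

(** With [u] replaced by its lower bound [m], the extension becomes [m] times the product of the
    block masses. *)
Lemma multilinear_ext_ge u z (m mu : R) : 0 <= m -> 0 <= mu ->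
  (forall s, m <= u s) -> (forall i a, 0 <= z i a) ->
  (forall i, mu <= \sum_a z i a) -> m * mu ^+ N <= multilinear_ext u z.
Proof.
move=> m0 mu0 mu_le z0 zmu.
have -> : mu ^+ N = \prod_(i < N) mu by rewrite prodr_const card_ord.
apply: (@le_trans _ _ (m * \prod_i \sum_(a : S i) z i a)).
  by rewrite ler_wpM2l // ler_prod // => i _; rewrite mu0 zmu.
rewrite prod_sum_dffun big_distrr ler_sum // => s _ /=.
by rewrite mulrC ler_wpM2l // prodr_ge0.
Qed.

Lemma dfwith_ge0 z i (q : S i -> R) : (forall j a, 0 <= z j a) ->
  (forall a, 0 <= q a) -> forall j a, 0 <= dfwith z q j a.
Proof. by move=> z0 q0 j; case: dfwithP. Qed.

Lemma mixed_dfwith z i (q : S i -> R) : mixed_profile z -> mixed q ->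
  mixed_profile (dfwith z q).
Proof. by move=> zm qm j; case: dfwithP. Qed.

Lemma multilinear_ext_gt0 u z : (forall s, 0 < u s) -> mixed_profile z ->
  0 < multilinear_ext u z.
Proof.
move=> /finite_pos_lower_bound[m m0 mu] zm.
apply: lt_le_trans (multilinear_ext_ge (ltW m0) ler01 mu _ _).
- by rewrite expr1n mulr1.
- by move=> i a; case: (zm i).
- by move=> i; case: (zm i) => _ ->.
Qed.

Lemma multilinear_ext_eq0 u v z : (forall s, 0 < u s) ->
  (forall i a, 0 <= z i a) -> multilinear_ext u z = 0 -> multilinear_ext v z = 0.
Proof.
move=> u0 z0 uz; apply: big1 => s _.
have w0 (t : {dffun forall i, S i}) : 0 <= (\prod_i z i (t i)) * u t.
  by rewrite mulr_ge0 ?prodr_ge0 // ltW.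
have /eqP : (\prod_i z i (s i)) * u s = 0.
  by apply: (psumr_eq0P _ uz) => // t _; apply: w0.
by rewrite mulf_eq0 [u s == 0]gt_eqF // orbF => /eqP ->; rewrite mul0r.
Qed.

Lemma bounded_lipschitz_multilinear_ext u i (a : S i) :
  is_bounded_lipschitz (fun x : {i : 'I_N & S i} -> R =>
    multilinear_ext u (dfwith (fun j b => x (Tagged S b)) (pure R a : S i -> R))).
Proof.
apply: bounded_lipschitz_sum => s; apply: bounded_lipschitzM; last exact: bounded_lipschitz_cst.
apply: (@eq_bounded_lipschitz _ _ (fun x : {i : 'I_N & S i} -> R =>
    pure R a (s i) * \prod_(j | j != i) x (Tagged S (s j)))).
  by move=> x; rewrite prod_dfwith.
apply: bounded_lipschitzM; first exact: bounded_lipschitz_cst.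
by apply: bounded_lipschitz_prod => j; apply: bounded_lipschitz_coord.
Qed.

End Multilinear.

(** * From the covering property to approximate equilibria *)

Section ApproximateEquilibrium.
Variables (R : realType) (N : nat) (S : 'I_N -> finType).
Variables (g f : 'I_N -> {dffun forall i, S i} -> R).
Hypotheses (S_gt0 : forall i, (0 < #|S i|)%N) (f_gt0 : forall i s, 0 < f i s).

Let C : finType := {i : 'I_N & S i}.

Let prof (x : C -> R) : forall i, S i -> R := fun i a => x (Tagged S a).

Let mass x i := \sum_a prof x (i := i) a.

Let G x i (a : S i) := multilinear_ext (g i) (dfwith (prof x) (pure R a : S i -> R)).

Let F x i (a : S i) := multilinear_ext (f i) (dfwith (prof x) (pure R a : S i -> R)).

(* [advantage a b x <= 0] says that [a] is at least as good as [b] against [x],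
   with denominators cleared. *)
Let advantage i (a b : S i) x := G x b * F x a - G x a * F x b.

Let pure_ge0 i (a : S i) b : 0 <= pure R a b.
Proof. exact: ler0n. Qed.

(* The ratio [G x a / F x a] is [0 / 0 = 0] when some opponent has mass zero, but
   then all advantages vanish, so its maximizer is a best reply in every case. *)
Let best_reply (i0 : 'I_N) x : mixed x -> exists c : C,
  (forall j, mass x (tag c) <= mass x j) /\
  forall b, advantage (tagged c) b x <= 0.
Proof.
move=> [x0 x1]; have pr0 j b : 0 <= prof x (i := j) b by exact: x0.
have [i _ imin] := @arg_minP _ _ _ i0 xpredT (mass x) isT.
have /card_gt0P[a0 _] := S_gt0 i.
have [a _ amax] := @arg_maxP _ _ _ a0 xpredT (fun a => G x a / F x a) isT.
exists (Tagged S a); split=> [j|b]; first exact: imin.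
rewrite /advantage /= subr_le0.
have F_ge0 c : 0 <= F x (c : S i).
  apply: sumr_ge0 => s _; apply: mulr_ge0; last exact: ltW.
  by apply: prodr_ge0 => j _; apply: dfwith_ge0.
have FG c : F x (c : S i) = 0 -> G x c = 0.
  by apply: multilinear_ext_eq0 => // j e; apply: dfwith_ge0.
have [Fb|Fb] := eqVneq (F x b) 0; first by rewrite FG // Fb mul0r mulr0.
have [Fa|Fa] := eqVneq (F x a) 0; first by rewrite (FG a) // Fa mul0r mulr0.
have /= := amax b isT.
by rewrite ler_pdivrMr ?lt_def ?Fb ?F_ge0 // mulrAC ler_pdivlMr // lt_def Fa F_ge0.
Qed.

Let card_le i : (#|S i| <= #|C|)%N.
Proof.
apply: (@leq_card _ _ (fun a : S i => Tagged S a : C)) => a b.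
exact: eq_from_Tagged.
Qed.

Let mass_lipschitz x z d i : (forall c, `|x c - z c| <= d) -> 0 <= d ->
  `|mass x i - mass z i| <= #|C|%:R * d.
Proof.
move=> xz d0; rewrite -sumrB (le_trans (ler_norm_sum _ _ _)) //.
apply: (@le_trans _ _ (\sum_(a : S i) d)); first by apply: ler_sum => a _; apply: xz.
by rewrite sumr_const -[leLHS]mulr_natl ler_wpM2r // ler_nat card_le.
Qed.

(** The heaviest block [j] has mass at least [1/N], so one of its coordinates exceeds [d] and its
    label is covered at a nearby [x], where [j] is the lightest block. Going from [z] to [x] and
    back costs at most [2 * #|C| * d <= 1/(2N)]. *)
Let mass_lower_bound z d : mixed z -> 0 <= d ->
    4 * N%:R * #|C|%:R * d <= 1 ->
    (forall c, z c <= d \/ exists x, [/\ mixed x,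
      (forall j, mass x (tag c) <= mass x j) /\
        (forall b, advantage (tagged c) b x <= 0) &
      forall c', `|x c' - z c'| <= d]) ->
  forall i, (2 * N%:R)^-1 <= mass z i.
Proof.
move=> [z0 z1] d0 dN zP i.
have N0 : 0 < N%:R :> R by rewrite ltr0n; case: N i => // -[].
have sum_mass : \sum_j mass z j = 1.
  by rewrite -z1 sig_big_dep /=; apply: eq_bigr => -[].
have [j _ jmax] := @arg_maxP _ _ _ i xpredT (mass z) isT.
have Cd : #|C|%:R * d <= (4 * N%:R)^-1.
  by rewrite -[leRHS]mul1r ler_pdivlMr ?mulr_gt0 // mulrC mulrA.
have jN : N%:R^-1 <= mass z j.
  rewrite -[leLHS]mul1r ler_pdivrMr // -[leLHS]sum_mass mulr_natr.
  rewrite -[N in _ *+ N]card_ord -sumr_const; apply: ler_sum => k _; exact: jmax.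
have [/existsP[a za]|] := boolP [exists a : S j, d < z (Tagged S a)]; last first.
  rewrite negb_exists => /forallP jd; exfalso.
  have : mass z j <= #|C|%:R * d.
    apply: (@le_trans _ _ (\sum_(a : S j) d)).
      by apply: ler_sum => a _; rewrite leNgt; apply: jd.
    by rewrite sumr_const -[leLHS]mulr_natl ler_wpM2r // ler_nat card_le.
  have N' : 0 < N%:R^-1 :> R by rewrite invr_gt0.
  move: Cd; rewrite invfM; lra.
have [|[x [xm [/(_ i)/= ji _] /mass_lipschitz xz]]] := zP (Tagged S a).
  by rewrite leNgt za.
have := xz i d0; have := xz j d0; rewrite !ler_norml.
move: Cd; rewrite !invfM; lra.
Qed.

Lemma approximate_equilibrium (eps : R) : (0 < N)%N -> 0 < eps ->
  exists p, mixed_profile p /\ forall i (a : S i),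
    loomis_payoff g f i (dfwith p (pure R a : S i -> R)) - loomis_payoff g f i p <= eps.
Proof.
move=> N_gt0 eps0; pose i0 := Ordinal N_gt0.
have N0 : 0 < N%:R :> R by rewrite ltr0n.
have [m m0 mf] : exists2 m, 0 < m & forall i s, m <= f i s.
  have [|m m0 mf] := @finite_pos_lower_bound R
      ('I_N * {dffun forall i, S i})%type (fun t => f t.1 t.2).
    by move=> [].
  by exists m => // i s; apply: (mf (i, s)).
have [K K0 KP] : exists2 K, 0 <= K & forall i (a b : S i), bounded_lipschitz K (advantage a b).
  have [|K K0 KP] := @bounded_lipschitz_unif R C {i : 'I_N & (S i * S i)%type}
      (fun t => advantage (tagged t).1 (tagged t).2).
    move=> [i [a b]] /=; apply: bounded_lipschitzD.
      by apply: bounded_lipschitzM; apply: bounded_lipschitz_multilinear_ext.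
    apply: (@eq_bounded_lipschitz _ _ (fun x => -1 * (G x a * F x b))) => [x|].
      by rewrite mulN1r.
    apply: bounded_lipschitzM; first exact: bounded_lipschitz_cst.
    by apply: bounded_lipschitzM; apply: bounded_lipschitz_multilinear_ext.
  by exists K => // i a b; apply: (KP (Tagged (fun i => (S i * S i)%type) (a, b))).
have /card_gt0P[a0 _] := S_gt0 i0.
have C0 : (0 < #|C|)%N by apply/card_gt0P; exists (Tagged S a0).
have C0' : 0 < #|C|%:R :> R by rewrite ltr0n.
(* [mu] will bound the block masses from below, and [w] the denominators. *)
pose mu : R := (2 * N%:R)^-1; have mu0 : 0 < mu by rewrite invr_gt0 mulr_gt0.
pose w := m * mu ^+ N; have w0 : 0 < w by rewrite mulr_gt0 // exprn_gt0.
(* The first term serves the mass bound, the second the final error estimate; [K + 1] avoids a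
   division by zero. *)
pose d := Num.min (4 * N%:R * #|C|%:R)^-1 (eps * w ^+ 2 / (#|C|%:R * (K + 1))).
have d0 : 0 < d.
  rewrite lt_min invr_gt0 !mulr_gt0 ?invr_gt0 ?mulr_gt0 ?exprn_gt0 //.
  by rewrite ltr_wpDl.
have dN : 4 * N%:R * #|C|%:R * d <= 1.
  by rewrite mulrC -ler_pdivlMr ?mulr_gt0 // mul1r /d ge_min lexx.
have dK : #|C|%:R * K * d <= eps * w ^+ 2.
  have dw : d <= eps * w ^+ 2 / (#|C|%:R * (K + 1)) by rewrite ge_min lexx orbT.
  have K1 : 0 < #|C|%:R * (K + 1) by rewrite mulr_gt0 // ltr_wpDl.
  move: dw; rewrite ler_pdivlMr // => /(le_trans _); apply.
  rewrite mulrC ler_wpM2l ?(ltW d0) // ler_wpM2l ?(ltW C0') // lerDl.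
  exact: ler01.
have [z [zm zP]] := kkm_cover C0 d0 (best_reply i0).
have zmass := mass_lower_bound zm (ltW d0) dN zP.
have z0 c : 0 <= z c by case: zm.
have mass0 i : 0 < mass z i by exact: lt_le_trans (zmass i).
pose p i (a : S i) := (mass z i)^-1 * prof z a.
have Fz i : w <= multilinear_ext (f i) (prof z).
  by apply: multilinear_ext_ge; rewrite ?ltW // => j a; apply: z0.
(* A block replaced by a pure strategy has mass [1], which must also be at least [mu]. *)
have mu1 : mu <= 1 by rewrite invf_le1 ?mulr_gt0 // -natrM ler1n muln_gt0.
have Fp i (a : S i) : w <= F z a.
  apply: multilinear_ext_ge; rewrite ?ltW //.
    apply: dfwith_ge0 => [j b|b]; [exact: z0 | exact: pure_ge0].
  move=> j; case: dfwithP => [|k _]; last exact: zmass.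
  by have [_ ->] := mixed_pure R a.
exists p; split=> [i|i b].
  split=> [a|]; first by rewrite mulr_ge0 ?z0 // invr_ge0 ltW.
  by rewrite -mulr_sumr mulVf // gt_eqF.
have payoff_pure : loomis_payoff g f i (dfwith p (pure R b : S i -> R)) = G z b / F z b.
  rewrite /loomis_payoff !multilinear_ext_scale_dfwith -mulf_div divff ?mul1r //.
  by rewrite gt_eqF // prodr_gt0 // => j _; rewrite invr_gt0.
have payoff_p : loomis_payoff g f i p =
    multilinear_ext (g i) (prof z) / multilinear_ext (f i) (prof z).
  rewrite /loomis_payoff !multilinear_ext_scale -mulf_div divff ?mul1r //.
  by rewrite gt_eqF // prodr_gt0 // => j _; rewrite invr_gt0.
have Fz0 := lt_le_trans w0 (Fz i); have Fb0 := lt_le_trans w0 (Fp i b).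
rewrite payoff_pure payoff_p -mulNr addf_div ?gt_eqF // ler_pdivrMr ?mulr_gt0 //.
(* With denominators cleared, the gain from [b] is the average of the advantages of [b] over each
   [a], weighted by the block [i] of [z]. *)
have -> : G z b * multilinear_ext (f i) (prof z) +
    - multilinear_ext (g i) (prof z) * F z b =
    \sum_a prof z (i := i) a * advantage a b z.
  rewrite (multilinear_ext_split (f i) (prof z) i) (multilinear_ext_split (g i) (prof z) i).
  rewrite mulNr mulr_sumr mulr_suml -sumrB; apply: eq_bigr => a _.
  by rewrite mulrBr mulrCA !mulrA.
apply: (@le_trans _ _ (eps * w ^+ 2)); last first.
  by rewrite ler_wpM2l ?(ltW eps0) // expr2 ler_pM ?(ltW w0).
apply: le_trans dK; apply: (@le_trans _ _ (\sum_(a : S i) K * d)); last first.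
  by rewrite sumr_const -[leLHS]mulr_natl -mulrA ler_wpM2r ?mulr_ge0 ?(ltW d0) // ler_nat card_le.
apply: ler_sum => a _.
have [_ /(_ z (fun c => mixed_le1 c zm))[bd li]] := KP i a b.
have /andP[_ za1] := mixed_le1 (Tagged S a) zm.
(* Each term is at most [K * d]: either the weight is at most [d] and the advantage at most [K], or
   [a] is a best reply at a point [x] within [d] of [z]. *)
have [zd|[x [xm [_ /(_ b)/= xb] xz]]] := zP (Tagged S a).
  rewrite mulrC (le_trans (ler_norm _)) // normrM ler_pM // ger0_norm //.
  exact: z0.
have {}li : `|advantage a b z - advantage a b x| <= K * d.
  by apply: li => [c||c]; [exact: mixed_le1 | exact: ltW | rewrite distrC].
have adv : advantage a b z <= K * d.
  by move: li; rewrite ler_norml => /andP[_]; rewrite lerBlDr => /le_trans; apply; rewrite gerDl.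
have [a0'|a0'] := leP 0 (advantage a b z).
  by rewrite (le_trans _ adv) // ler_piMl.
by rewrite (@le_trans _ _ 0) ?mulr_ge0 ?(ltW d0) // mulr_ge0_le0 ?z0 // ltW.
Qed.

End ApproximateEquilibrium.

(** * Pure replies and the maximal gain *)

Section PureReplies.
Variables (R : realType) (N : nat) (S : 'I_N -> finType).
Variables (g f : 'I_N -> {dffun forall i, S i} -> R).
Hypothesis f_gt0 : forall i s, 0 < f i s.
Let h := loomis_payoff g f.
Implicit Type p : forall i, S i -> R.

(* The payoff of a mixed reply is a mediant of the payoffs of pure replies. *)
Lemma loomis_payoff_le p i (q : S i -> R) (M : R) : mixed_profile p -> mixed q ->
  (forall a, h i (dfwith p (pure R a : S i -> R)) <= M) -> h i (dfwith p q) <= M.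
Proof.
move=> pm qm hM; have [q0 _] := qm.
rewrite /h /loomis_payoff ler_pdivrMr; last first.
  by apply: multilinear_ext_gt0 => //; apply: mixed_dfwith.
rewrite !(multilinear_ext_dfwith _ _ q) mulr_sumr ler_sum // => a _.
rewrite mulrCA ler_wpM2l // -ler_pdivrMr ?hM //.
by apply: multilinear_ext_gt0 => //; apply/mixed_dfwith/mixed_pure.
Qed.

Lemma loomis_payoff_id p i : h i (dfwith p (p i)) = h i p.
Proof. by rewrite /h /loomis_payoff !multilinear_ext_id. Qed.

Lemma max_pure_gain_leP p (M : R) :
  (max_pure_gain h p <= M%:E)%E <->
  forall i (a : S i), h i (dfwith p (pure R a : S i -> R)) - h i p <= M.
Proof.
split=> [/bigmax_leP[_ H] i a|H].
  have /bigmax_leP[_ /(_ a isT)] := H i isT.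
  by rewrite lee_fin.
apply/bigmax_leP; split=> [|i _]; first exact: leNye.
by apply/bigmax_leP; split=> [|a _]; rewrite ?leNye // lee_fin.
Qed.

(** By the mediant bound for the reply [p i], the best pure reply does at least as well as [p i]. *)
Lemma max_pure_gain_ge0 p : (0 < N)%N -> (forall i, (0 < #|S i|)%N) ->
  mixed_profile p -> (0 <= max_pure_gain h p)%E.
Proof.
move=> N_gt0 S_gt0 pm; pose i := Ordinal N_gt0; have /card_gt0P[a0 _] := S_gt0 i.
have [a _ amax] := @arg_maxP _ _ _ a0 xpredT
  (fun a => h i (dfwith p (pure R a : S i -> R))) isT.
apply: bigmax_sup (isT : predT i) _; apply: bigmax_sup (isT : predT a) _.
rewrite lee_fin subr_ge0 -(loomis_payoff_id p i).
by apply: loomis_payoff_le => // b; apply: amax.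
Qed.

End PureReplies.

(** * Equilibria as minimizers of the maximal gain *)

Theorem corollary4p5 (R : realType) (N : nat) (N_gt0 : (0 < N)%N)
    (S : 'I_N -> finType) (S_gt0 : forall i, (0 < #|S i|)%N)
    (g f : 'I_N -> {dffun forall i, S i} -> R)
    (f_gt0 : forall i s, 0 < f i s)
    (p0 : forall i, S i -> R) (p0_mixed : mixed_profile p0) :
  nash (fun i => @mixed R (S i)) (loomis_payoff g f) p0 <->
  argmin (@mixed_profile R N S) (max_pure_gain (loomis_payoff g f)) p0.
Proof.
split=> [[_ p0_nash]|[_ p0_min]].
  (* The value [0] separates: the gain is at most [0] at an equilibrium and at least [0] at every
     profile. *)
  split=> // y ym; apply: (@le_trans _ _ 0%E); last exact: max_pure_gain_ge0.
  apply/max_pure_gain_leP => i a; rewrite subr_le0.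
  by apply: p0_nash; apply: mixed_pure.
split=> // i q qm; apply: loomis_payoff_le => // a.
(* A minimizer gains no more than an [eps]-equilibrium does, for every positive [eps], so no limit
   point is needed. *)
apply/ler_addgt0Pr => eps eps0.
have [p [pm p_eps]] := approximate_equilibrium g S_gt0 f_gt0 N_gt0 eps0.
have : (max_pure_gain (loomis_payoff g f) p0 <= eps%:E)%E.
  exact/(le_trans (p0_min p pm))/max_pure_gain_leP.
by move=> /max_pure_gain_leP/(_ i a); rewrite lerBlDl.
Qed.
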